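(* There exists an absolute constant $c_1>0$ such that for every prime power $q$ the sum-product digraph $G_1$ over $M_2(\mathbb{F}_q)$ is a $(q^8, q^4, c_1 q^{7/2})$-digraph.
   Context: $\mathbb{F}_q$ is the finite field with $q$ elements and $M_2(\mathbb{F}_q)$ is the ring of $2\times 2$ matrices over $\mathbb{F}_q$. The sum-product digraph $G_1$ has vertex set $M_2(\mathbb{F}_q)\times M_2(\mathbb{F}_q)$, with a directed edge from $(A,C)$ to $(B,D)$ if and only if $AB=C+D$. For a digraph $G$ on $n$ vertices in which every vertex has in-degree and out-degree $d$, with adjacency matrix $A_G$ (entry $1$ at $(u,w)$ iff there is a directed edge from $u$ to $w$) having complex eigenvalues $\lambda_1=d,\lambda_2,\dots,\lambda_n$ (all satisfying $|\lambda_i|\le d$), set $\lambda(G)=\max\{|\lambda_i|: |\lambda_i|\neq d\}$. $G$ is an $(n,d,\lambda)$-digraph if it has $n$ vertices, every vertex has in-degree and out-degree $d$, and $\lambda(G)\le\lambda$. *)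

(* Defs.v *)
From HB Require Import structures.
From mathcomp Require Import all_boot all_order all_algebra.
From mathcomp Require Import complex.
From mathcomp Require Import reals exp.

Set Implicit Arguments.
Unset Strict Implicit.
Unset Printing Implicit Defensive.

Import Order.TTheory GRing.Theory Num.Theory.

Local Open Scope ring_scope.

(* A digraph (loops allowed) on a finType V is its edge relation e : rel V;
   e u w means that there is a directed edge from u to w. *)

Definition out_degree (V : finType) (e : rel V) (u : V) : nat :=
  #|[set w | e u w]|.

Definition in_degree (V : finType) (e : rel V) (u : V) : nat :=
  #|[set w | e w u]|.

Definition adjacency_mx (K : pzRingType) (V : finType) (e : rel V) :
    'M[K]_#|V| :=
  \matrix_(i, j) (e (enum_val i) (enum_val j))%:R.

(* lambda_1, ..., lambda_n, listed with algebraic multiplicity. *)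
Definition eigenvalues (R : rcfType) (n : nat) (A : 'M[R[i]]_n) : seq R[i] :=
  sval (closed_field_poly_normal (char_poly A)).

Lemma char_poly_eigenvalues (R : rcfType) (n : nat) (A : 'M[R[i]]_n) :
  char_poly A = \prod_(z <- eigenvalues A) ('X - z%:P).
Proof.
rewrite /eigenvalues; case: closed_field_poly_normal => r /= {1}->.
by rewrite (monicP (char_poly_monic A)) scale1r.
Qed.

Lemma mem_eigenvalues (R : rcfType) (n : nat) (A : 'M[R[i]]_n) (z : R[i]) :
  (z \in eigenvalues A) = eigenvalue A z.
Proof. by rewrite eigenvalue_root_char char_poly_eigenvalues root_prod_XsubC. Qed.

(* lambda(G) for a d-regular digraph; the maximum over the empty family is 0.
   normc is the complex modulus with values in R. *)
Definition digraph_lambda (R : rcfType) (V : finType) (e : rel V) (d : nat) :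
    R :=
  \big[Num.max/0]_(z <- eigenvalues (adjacency_mx R[i] e)
                  | ComplexField.Normc.normc z != d%:R)
    ComplexField.Normc.normc z.

Definition ndl_digraph (R : rcfType) (V : finType) (e : rel V)
    (n d : nat) (l : R) : Prop :=
  [/\ #|V| = n,
      forall u : V, in_degree e u = d,
      forall u : V, out_degree e u = d &
      digraph_lambda R e d <= l].

Definition sum_product_digraph (F : finFieldType) :
    rel ('M[F]_2 * 'M[F]_2)%type :=
  fun u w => u.1 *m w.1 == u.2 + w.2.

(* Main.v *)
(* The all-ones vector is a left and right eigenvector for [d], so an eigenvector
   for [z != d] is orthogonal to it.  Hence [|z|^2] is bounded by the quadratic
   form of [M M^T - J] on that eigenvector, where [M] is the adjacency matrix and
   [J] the all-ones matrix, and Schur's test bounds this by the maximal absolute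
   row sum of [M M^T - J].  The entry of [M M^T] at [(A, C)], [(A', C')] is the
   number of [B] with [(A - A') B = C - C'].  It is [1] when [A - A'] is
   invertible; for any of the at most [2 q^3] other [A'], these numbers add up
   to [q^4] over the [q^4] choices of [C'].  The row sums are thus at most
   [2 q^3 * 2 q^4 = 4 q^7]. *)

Require Import Defs.
From HB Require Import structures.
From mathcomp Require Import all_boot all_order all_algebra.
From mathcomp Require Import complex.
From mathcomp Require Import reals exp.
From mathcomp Require Import all_fingroup zify.

Set Implicit Arguments.
Unset Strict Implicit.
Unset Printing Implicit Defensive.

Import Order.TTheory GRing.Theory Num.Theory.
Local Open Scope ring_scope.

(** By AM-GM, [2 |x u| |x w| <= |x u|^2 + |x w|^2]; by symmetry of [S], both squares contribute the
    same row-sum expression [T]. *)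
Lemma schur_test (C : numClosedFieldType) (V : finType) (S : V -> V -> C)
    (B : C) (x : V -> C) :
    (forall u w, S u w = S w u) ->
    (forall u, \sum_w `|S u w| <= B) ->
  `|\sum_u \sum_w x u * (x w)^* * S u w| <= B * \sum_u `|x u| ^+ 2.
Proof.
move=> Ssym Srow.
rewrite -(@ler_pM2l _ 2) ?ltr0n //.
pose T := \sum_u \sum_w `|x u| ^+ 2 * `|S u w|.
have T_le : T <= B * \sum_u `|x u| ^+ 2.
  rewrite mulr_sumr; apply: ler_sum => u _.
  by rewrite -mulr_sumr mulrC ler_wpM2r // exprn_ge0.
apply: le_trans (_ : T + T <= _); last by rewrite mulr2n mulrDl mul1r lerD.
have -> : T + T = \sum_u \sum_w (`|x u| ^+ 2 + `|x w| ^+ 2) * `|S u w|.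
  rewrite {2}/T exchange_big -big_split; apply: eq_bigr => u _.
  by rewrite -big_split; apply: eq_bigr => w _; rewrite mulrDl (Ssym w).
rewrite (le_trans (ler_wpM2l _ (ler_norm_sum _ _ _))) // mulr_sumr.
apply: ler_sum => u _.
rewrite (le_trans (ler_wpM2l _ (ler_norm_sum _ _ _))) // mulr_sumr.
apply: ler_sum => w _.
rewrite !normrM norm_conjC mulrA ler_wpM2r // mulr_natl.
exact: real_leif_mean_square_scaled (normr_real _) (normr_real _).
Qed.

(** The entry of [M M^T] at [(u, w)], for [M] the adjacency matrix. *)
Definition codegree (V : finType) (e : rel V) (u w : V) : nat :=
  #|[set z | e u z && e w z]|.

Lemma codegreeC (V : finType) (e : rel V) u w :
  codegree e u w = codegree e w u.
Proof. by apply: eq_card => z; rewrite !inE andbC. Qed.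

Lemma sum_rel_nat (K : pzSemiRingType) (V : finType) (p : pred V) :
  \sum_z (p z)%:R = #|[set z | p z]|%:R :> K.
Proof.
rewrite -sum1_card natr_sum [RHS]big_mkcond; apply: eq_bigr => z _.
by rewrite inE; case: (p z).
Qed.

Lemma eigenvalue_codegree_bound (C : numClosedFieldType) (V : finType)
    (e : rel V) (d B : nat) (z : C) :
    (forall u, out_degree e u = d) ->
    (forall u, \sum_w `|(codegree e u w)%:R - 1| <= B%:R :> C) ->
  eigenvalue (adjacency_mx C e) z -> z != d%:R -> `|z| ^+ 2 <= B%:R.
Proof.
move=> outd rowB /eigenvalueP[v vA v0] zd.
pose x u := v 0 (enum_rank u).
have xA w : \sum_u x u * (e u w)%:R = z * x w.
  have := congr1 (fun M : 'rV_#|V| => M 0 (enum_rank w)) vA.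
  rewrite !mxE => <-; rewrite (reindex enum_rank); last first.
    exact/onW_bij/enum_rank_bij.
  by apply: eq_bigr => u _; rewrite !mxE !enum_rankK.
(* Summing [xA] over [w] gives [d * \sum_u x u = z * \sum_u x u], and [z != d]. *)
have sumx : \sum_u x u = 0.
  have : \sum_w \sum_u x u * (e u w)%:R = z * \sum_u x u.
    by rewrite mulr_sumr; apply: eq_bigr => w _.
  rewrite exchange_big /=.
  under eq_bigr do rewrite -mulr_sumr sum_rel_nat -/(out_degree e _) outd.
  rewrite -mulr_suml mulrC => /eqP; rewrite -subr_eq0 -mulrBl mulf_eq0 subr_eq0.
  by rewrite eq_sym (negbTE zd) => /eqP.
have normx : 0 < \sum_u `|x u| ^+ 2.
  rewrite lt_neqAle sumr_ge0 ?andbT; last by move=> u _; rewrite exprn_ge0.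
  apply: contraNneq v0 => /esym/eqP.
  rewrite psumr_eq0 => [/allP x0|u _]; last by rewrite exprn_ge0.
  apply/eqP/rowP => i; rewrite mxE.
  have := x0 (enum_val i) (mem_index_enum _).
  by rewrite expf_eq0 normr_eq0 /x enum_valK => /eqP.
rewrite -(ler_pM2r normx).
apply: le_trans (@schur_test _ _ (fun u w => (codegree e u w)%:R - 1) _ x _ rowB);
  last by move=> u w; rewrite codegreeC.
(* The [- 1] terms, which form [J], contribute nothing because [\sum_u x u = 0]. *)
suff <- : `|z| ^+ 2 * \sum_u `|x u| ^+ 2 =
    \sum_u \sum_w x u * (x w)^* * ((codegree e u w)%:R - 1).
  by rewrite real_ler_norm // ger0_real // mulr_ge0 ?exprn_ge0 // ltW.
under [RHS]eq_bigr do under eq_bigr do rewrite mulrBr mulr1.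
under [RHS]eq_bigr do rewrite sumrB -mulr_sumr -rmorph_sum sumx rmorph0 mulr0 subr0.
rewrite mulr_sumr.
(* Expand [|z * x y|^2] by [xA] as a double sum over [u] and [w]; summing over [y] first then
   produces the codegrees. *)
transitivity (\sum_y \sum_u \sum_w
    x u * (x w)^* * ((e u y)%:R * (e w y)%:R)).
  apply: eq_bigr => y _.
  rewrite -exprMn -normrM -xA normCK rmorph_sum mulr_suml.
  apply: eq_bigr => u _; rewrite mulr_sumr; apply: eq_bigr => w _.
  by rewrite rmorphM rmorph_nat mulrACA.
rewrite exchange_big; apply: eq_bigr => u _.
rewrite exchange_big; apply: eq_bigr => w _.
rewrite -mulr_sumr; congr (_ * _); rewrite -sum_rel_nat.
by apply: eq_bigr => y _; rewrite -natrM mulnb.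
Qed.

(** Since [|GL_2| = q (q - 1)^2 (q + 1)], the exact count is [q^3 + q^2 - q]. *)
Lemma card_nonunitmx2 (F : finFieldType) :
  (#|[set A : 'M[F]_2 | A \notin unitmx]| <= 2 * #|F| ^ 3)%N.
Proof.
have := cardsC [set A : 'M[F]_2 | A \in unitmx].
have -> : #|[set A : 'M[F]_2 | A \in unitmx]| = (#|F| * #|F|.-1 ^ 2 * #|F|.+1)%N.
  by rewrite -card_GL_2 cardsT card_sub cardsE.
have -> : ~: [set A : 'M[F]_2 | A \in unitmx] = [set A : 'M[F]_2 | A \notin unitmx].
  by apply/setP => A; rewrite !inE.
rewrite card_mx.
have : (0 < #|F|)%N by apply/card_gt0P; exists 0.
case: #|F| => // n _ /=; nia.
Qed.

Section SumProduct.

Variable F : finFieldType.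
Local Notation E := (@sum_product_digraph F).
Local Notation q := #|F|.

(** The out-neighbours of [(A, C)] form the graph of the map [B |-> A B - C]. *)
Lemma sum_product_out_degree u : out_degree E u = (q ^ 4)%N.
Proof.
rewrite -[RHS](card_mx F 2 2) -cardsT /out_degree.
have f_inj : injective (fun B : 'M[F]_2 => (B, u.1 *m B - u.2)) by move=> B B' [].
rewrite -(card_imset _ f_inj); apply: eq_card => -[B D]; rewrite inE.
apply/idP/imsetP => [/eqP /= eBD|[B' _ [-> ->]]]; last first.
  by rewrite /sum_product_digraph /= addrC subrK.
by exists B; rewrite // eBD addrC addKr.
Qed.

Lemma sum_product_in_degree u : in_degree E u = (q ^ 4)%N.
Proof.
rewrite -[RHS](card_mx F 2 2) -cardsT /in_degree.
have f_inj : injective (fun A : 'M[F]_2 => (A, A *m u.1 - u.2)) by move=> A A' [].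
rewrite -(card_imset _ f_inj); apply: eq_card => -[A C]; rewrite inE.
apply/idP/imsetP => [/eqP /= eAC|[A' _ [-> ->]]]; last first.
  by rewrite /sum_product_digraph /= subrK.
by exists A; rewrite // eAC addrK.
Qed.

(** Subtracting [A' B = C' + D] from [A B = C + D] determines [B], and then [D = A B - C]. *)
Lemma sum_product_codegree_unit (A A' C C' : 'M[F]_2) :
  A - A' \in unitmx -> codegree E (A, C) (A', C') = 1%N.
Proof.
move=> uA; pose B := invmx (A - A') *m (C - C').
apply/eqP/cards1P; exists (B, A *m B - C); apply/setP => -[B' D].
rewrite !inE /sum_product_digraph /=.
apply/andP/eqP => [[/eqP e1 /eqP e2]|[-> ->]].
  have eB : B' = B.
    apply: (can_inj (mulKmx uA)); rewrite mulKVmx // mulmxBl e1 e2.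
    by rewrite opprD addrACA subrr addr0.
  by rewrite -eB e1 addrC addKr.
have := mulKVmx uA (C - C'); rewrite -/B mulmxBl => eB.
rewrite addrC subrK eqxx /= -[X in X == _](subKr (A *m B)) eB opprB.
by rewrite addrCA.
Qed.

(** Each out-neighbour [(B, D)] of [u] is counted for exactly one [C'], namely [A' B - D], so the
    sum is the out-degree of [u]. *)
Lemma sum_product_codegree_sum u (A' : 'M[F]_2) :
  (\sum_C' codegree E u (A', C') = q ^ 4)%N.
Proof.
rewrite -(sum_product_out_degree u) /out_degree /codegree.
under eq_bigr do rewrite cardsE -sum1_card big_mkcondr /=.
rewrite exchange_big cardsE -sum1_card /=; apply: eq_bigr => -[B D] _.
rewrite (bigD1 (A' *m B - D)) //= /sum_product_digraph /= subrK eqxx.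
rewrite big1 // => C' neC'; case: eqP => // eC'.
by rewrite eC' addrK eqxx in neC'.
Qed.

Lemma sum_product_codegree_row (K : numDomainType) u :
  \sum_w `|(codegree E u w)%:R - 1| <= (4 * q ^ 7)%N%:R :> K.
Proof.
case: u => A C.
pose G (A' : 'M[F]_2) := \sum_C' `|(codegree E (A, C) (A', C'))%:R - 1| : K.
have -> : \sum_w `|(codegree E (A, C) w)%:R - 1| = \sum_A' G A' :> K.
  by rewrite /G pair_big; apply: eq_bigr => -[].
have G_unit A' : A - A' \in unitmx -> G A' = 0.
  move=> uA; rewrite /G big1 // => C' _.
  by rewrite sum_product_codegree_unit // subrr normr0.
(* From [|k - 1| <= k + 1]: the codegrees add up to [q^4], and so do the ones. *)
have G_le A' : G A' <= (2 * q ^ 4)%N%:R.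
  apply: le_trans (_ : \sum_C' ((codegree E (A, C) (A', C'))%:R + 1) <= _).
    by apply: ler_sum => C' _; rewrite (le_trans (ler_normB _ _)) // normr1 normr_nat.
  rewrite big_split /= -natr_sum sum_product_codegree_sum sumr_const card_mx.
  by rewrite -natrD addnn mul2n.
rewrite (bigID (fun A' => A - A' \in unitmx)) /= big1 // add0r.
apply: le_trans (ler_sum _ (fun A' _ => G_le A')) _.
rewrite sumr_const -[_ *+ _]mulr_natr -natrM ler_nat.
have -> : #|[pred A' | A - A' \notin unitmx]| = #|[set M : 'M[F]_2 | M \notin unitmx]|.
  have f_inj : injective (fun M : 'M[F]_2 => A - M) by move=> M M' /addrI/oppr_inj.
  rewrite -(card_imset _ f_inj); apply: eq_card => M; rewrite inE.
  apply/idP/imsetP => [uM|[M' + ->]]; last by rewrite inE opprB addrC subrK.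
  by exists (A - M); rewrite ?inE // opprB addrC subrK.
apply: leq_trans (leq_mul (leqnn _) (card_nonunitmx2 F)) _.
by rewrite mulnACA -expnD.
Qed.

End SumProduct.

Theorem theorem5p2 (R : realType) :
  exists c1 : R, 0 < c1 /\
    forall (q : nat) (F : finFieldType), #|F| = q ->
      ndl_digraph (@sum_product_digraph F) (q ^ 8)%N (q ^ 4)%N
        (c1 * (q%:R `^ (7 / 2))).
Proof.
(* The constant is the square root of the 4 in the row bound [4 q^7]. *)
exists 2; split=> // q F <-; split.
- by rewrite card_prod card_mx -expnD.
- exact: sum_product_in_degree.
- exact: sum_product_out_degree.
(* Needed for the default value 0 of the maximum and for comparing squares below. *)
have c_ge0 : 0 <= 2 * #|F|%:R `^ (7 / 2) :> R by rewrite mulr_ge0 ?powR_ge0.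
have normcE z : (ComplexField.Normc.normc z)%:C%C = `|z| :> R[i] by [].
rewrite /digraph_lambda big_seq_cond; apply: bigmax_le => // z /andP[].
rewrite mem_eigenvalues => ev zd.
(* [digraph_lambda] excludes eigenvalues by modulus, which is stronger than [z != d]. *)
have zd' : z != (#|F| ^ 4)%N%:R.
  apply: contraNneq zd => ->.
  by apply/eqP/complexI; rewrite normcE normr_nat rmorph_nat.
have := eigenvalue_codegree_bound (@sum_product_out_degree F)
  (@sum_product_codegree_row F _) ev zd'.
rewrite -normcE -rmorphXn -(rmorph_nat (real_complex R)) lecR => le_z.
rewrite -(@ler_pXn2r _ 2) ?nnegrE //; last by case: (z) => a b; exact: sqrtr_ge0.
apply: le_trans le_z _.
rewrite exprMn -[_ `^ _ ^+ 2]powR_mulrn ?powR_ge0 // -powRrM divfK ?pnatr_eq0 //.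
by rewrite powR_mulrn ?ler0n // -!natrX -natrM.
Qed.
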